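(* Let $\mathbf{x} = y f(\mathbf{z})$ be a quasi-Sturmian sequence, where $y$ is a finite word, $\mathbf{z}$ is a Sturmian sequence over $\{0,1\}$, and $f$ is an aperiodic morphism from $\{0,1\}^*$ to $B^*$ for some finite alphabet $B$. Then either $f(\mathbf{z})$ is reversal-closed and $r_{\mathbf{x}}(n) = \frac{n}{2} + O(1)$, or else $f(\mathbf{z})$ is not reversal-closed and $r_{\mathbf{x}}(n) = n + O(1)$.
   Context: A factor of a sequence is a finite contiguous block. For a finite word $u=u(1)\cdots u(m)$, its reversal is $u^R=u(m)\cdots u(1)$; $u$ and $v$ are reflectively equivalent if $v=u$ or $v=u^R$. The reflection complexity $r_{\mathbf{x}}(n)$ is the number of distinct length-$n$ factors of $\mathbf{x}$ up to reflective equivalence; the factor complexity $\rho_{\mathbf{x}}(n)$ is the number of distinct length-$n$ factors. A sequence is Sturmian if $\rho(n)=n+1$ for all $n$; it is quasi-Sturmian if there is a constant $C$ with $\rho(n)=n+C$ for all large $n$. A morphism $f$ satisfies $f(uv)=f(u)f(v)$; it is aperiodic if $f(01)\neq f(10)$; it is extended to infinite sequences letterwise. A sequence is reversal-closed if for every factor $w$, $w^R$ is also a factor. Asymptotics are as $n\to\infty$. *)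

(* Defs.v *)
From mathcomp Require Import all_boot all_order all_algebra.
From mathcomp Require Import all_classical all_reals all_analysis.

Set Implicit Arguments.
Unset Strict Implicit.
Unset Printing Implicit Defensive.

(* Infinite sequences over [A] are functions [nat -> A], indexed from 0. *)

Definition is_factor (A : eqType) (x : nat -> A) (w : seq A) : Prop :=
  exists i, w = mkseq (fun k => x (i + k)) (size w).

Definition factors (A : finType) (x : nat -> A) (n : nat) : {set n.-tuple A} :=
  [set w : n.-tuple A | `[< is_factor x w >]].

Definition factor_complexity (A : finType) (x : nat -> A) (n : nat) : nat :=
  #|factors x n|.

Definition refl_equiv (A : eqType) : rel (seq A) :=
  [rel u v | (v == u) || (v == rev u)].

Definition reflection_complexity (A : finType) (x : nat -> A) (n : nat) : nat :=
  #|equivalence_partition (fun u v : n.-tuple A => refl_equiv u v)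
                          (factors x n)|.

Definition sturmian (A : finType) (x : nat -> A) : Prop :=
  forall n, factor_complexity x n = n.+1.

Definition quasi_sturmian (A : finType) (x : nat -> A) : Prop :=
  exists (C : int) (N : nat), forall n, N <= n ->
    ((factor_complexity x n)%:Z = n%:Z + C)%R.

Definition reversal_closed (A : eqType) (x : nat -> A) : Prop :=
  forall w, is_factor x w -> is_factor x (rev w).

Definition word_morphism (A B : Type) (f : seq A -> seq B) : Prop :=
  forall u v, f (u ++ v) = f u ++ f v.

(* The letters 0 and 1 are [false] and [true]. *)
Definition aperiodic_morphism (B : Type) (f : seq bool -> seq B) : Prop :=
  f [:: false; true] <> f [:: true; false].

(* [w] is the infinite word f(z(0)) f(z(1)) f(z(2)) ...: each prefix of [w] is a
   prefix of the image of some prefix of [z].  For a morphism [f] there is at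
   most one such [w], and there is none exactly when the concatenation is
   finite; an aperiodic morphism is non-erasing, so then [w] exists. *)
Definition is_image (A : Type) (B : eqType) (f : seq A -> seq B)
    (z : nat -> A) (w : nat -> B) : Prop :=
  forall n, exists m, prefix (mkseq w n) (f (mkseq z m)).

(* The sequence y w; [nth] returns its default past the end of [y]. *)
Definition prepend (A : Type) (y : seq A) (w : nat -> A) : nat -> A :=
  fun n => nth (w (n - size y)) y n.

(* Main.v *)
Require Import Defs.
From mathcomp Require Import all_boot all_order all_algebra.
From mathcomp Require Import all_classical all_reals all_analysis.
From mathcomp Require Import zify lra.
Import numFieldNormedType.Exports.

Set Implicit Arguments.
Unset Strict Implicit.
Unset Printing Implicit Defensive.

(* Write w for f(z).  Sturmian words are uniformly recurrent, hence so is w.  The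
   factor complexities of w and x differ by at most |y|, so that of w is
   n + O(1), and so the number of right special factors of w is bounded.

   If w is not reversal-closed, some factor v of w has a reversal that is not a
   factor; all long factors of w contain v, so no long factor has a reversal
   that is a factor, and reflection identifies no two long factors of w.

   If w is reversal-closed, call a factor special if it or its reversal is right
   special.  Reversal maps a path of non-special factors joining two special ones
   in the Rauzy graph to such a path, and a non-special palindrome is the middle
   of the path through it.  There are boundedly many such paths, so boundedly
   many palindromes of each length; all other reflection classes in w have
   exactly two elements. *)

(** * Windows of a sequence and the counting of right special ones *)

Definition window (A : Type) (x : nat -> A) (i n : nat) : n.-tuple A :=
  [tuple of mkseq (fun k => x (i + k)) n].

Section Windows.

Variables (A : finType) (x : nat -> A).

Lemma nth_window a i n k : k < n -> nth a (window x i n) k = x (i + k).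
Proof. by move=> kn; rewrite nth_mkseq. Qed.

Lemma eq_window i j n :
  window x i n = window x j n <-> (forall k, k < n -> x (i + k) = x (j + k)).
Proof.
split=> [e k kn|e].
  by rewrite -(nth_window (x 0) i kn) e nth_window.
apply: val_inj; apply: (@eq_from_nth _ (x 0)); rewrite !size_tuple // => k kn.
by rewrite !nth_window // e.
Qed.

Lemma window_shift i j n m t :
  t + m <= n -> window x i n = window x j n ->
  window x (i + t) m = window x (j + t) m.
Proof.
by move=> tmn /eq_window e; apply/eq_window => k km; rewrite -!addnA e //; lia.
Qed.

Lemma windowS i j n : window x i n = window x j n -> x (i + n) = x (j + n) ->
  window x i n.+1 = window x j n.+1.
Proof.
move=> /eq_window e en; apply/eq_window => k; rewrite ltnS leq_eqVlt.
by case/orP => [/eqP -> //|/e].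
Qed.

Lemma in_factors n (u : n.-tuple A) :
  reflect (exists i, u = window x i n) (u \in factors x n).
Proof.
rewrite inE; apply: (iffP (asboolP _)) => -[i e]; exists i.
  by apply: val_inj; rewrite /= e size_tuple.
by rewrite e size_tuple.
Qed.

Lemma mem_window i n : window x i n \in factors x n.
Proof. by apply/in_factors; exists i. Qed.

(* Windows starting in a prescribed set of positions, so that the counting
   below applies to finite stretches of [x] as well as to [x] itself. *)
Definition windows_at (I : nat -> Prop) n : {set n.-tuple A} :=
  [set u : n.-tuple A | `[< exists2 i, I i & u = window x i n >]].

Definition right_special_at (I : nat -> Prop) n : {set n.-tuple A} :=
  [set u : n.-tuple A | `[< exists i j, [/\ I i, I j, u = window x i n,
     window x i n = window x j n & x (i + n) <> x (j + n)] >]].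

Lemma factorsE n : factors x n = windows_at (fun=> True) n.
Proof.
apply/finset.setP => u; apply/in_factors/idP => [[i ->]|]; rewrite inE.
  by apply/asboolP; exists i.
by move/asboolP => -[i _ ->]; exists i.
Qed.

(** One chosen right extension [G u] per window [u] embeds length [n] into length [n.+1]. A right
    special window has a second extension, outside the image of [G], and [res] recovers the window
    from it. *)
Lemma leq_card_right_special (I : nat -> Prop) n :
  #|right_special_at I n| + #|windows_at I n| <= #|windows_at I n.+1|.
Proof.
pose res (v : n.+1.-tuple A) := insubd (window x 0 n) (take n v).
have resE i : res (window x i n.+1) = window x i n.
  apply: val_inj; rewrite val_insubd size_take size_tuple ltnSn eqxx.
  apply: (@eq_from_nth _ (x 0)); first by rewrite size_take !size_tuple ltnSn.
  rewrite size_take size_tuple ltnSn => k kn.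
  by rewrite nth_take // !nth_window // ltnW.
have /choice[g gP] : forall u, exists i,
    u \in windows_at I n -> I i /\ u = window x i n.
  move=> u; have [|nu] := boolP (u \in windows_at I n); last by exists 0.
  by rewrite inE => /asboolP[i Ii ->]; exists i.
pose G u := window x (g u) n.+1.
have GK : {in windows_at I n, cancel G res}.
  by move=> u /gP[_ {2}->]; rewrite /G resE.
have subG : G @: windows_at I n \subset windows_at I n.+1.
  apply/fintype.subsetP => _ /imsetP[u /gP[Iu _] ->].
  by rewrite inE; apply/asboolP; exists (g u).
rewrite -(card_in_imset (can_in_inj GK)).
rewrite -(cardsID (G @: windows_at I n) (windows_at I n.+1)).
rewrite (finset.setIidPr subG) addnC leq_add2l.
apply: leq_trans (leq_imset_card res _); apply/subset_leq_card/fintype.subsetP => u.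
rewrite inE => /asboolP[i [j [Ii Ij -> e ne]]]; apply/imsetP.
have Wi : window x i n \in windows_at I n by rewrite inE; apply/asboolP; exists i.
have key k : I k -> window x k n = window x i n ->
    x (k + n) <> x (g (window x i n) + n) ->
    window x k n.+1 \in windows_at I n.+1 :\: G @: windows_at I n.
  move=> Ik ek nk; rewrite finset.in_setD; apply/andP; split; last first.
    by rewrite inE; apply/asboolP; exists k.
  apply/negP => /imsetP[v vI ev]; apply: nk.
  have ve : v = window x i n by rewrite -(GK v vI) -ev resE.
  by move: ev; rewrite /G ve => /eq_window; apply.
have [ei|ni] := pselect (x (i + n) = x (g (window x i n) + n)).
  exists (window x j n.+1); last by rewrite resE.
  by apply: key => //; rewrite -ei => /esym.
by exists (window x i n.+1); [exact: key|rewrite resE].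
Qed.

Lemma pigeonhole_window a n :
  exists i j, [/\ a <= i, i < j, j <= a + #|A| ^ n & window x i n = window x j n].
Proof.
pose h (k : 'I_(#|A| ^ n).+1) := window x (a + k) n.
have /injectivePn[k [l kl e]] : ~~ injectiveb h.
  apply/negP => /injectiveP /leq_card.
  by rewrite card_ord card_tuple ltnn.
wlog lt_kl : k l kl e / k < l.
  move=> H; have [/H|lk|/val_inj kle] := ltngtP k l; first exact.
    by apply: (H l k) => //; rewrite eq_sym.
  by rewrite kle eqxx in kl.
exists (a + k), (a + l); split => //; have := ltn_ord l; lia.
Qed.

(** Each agreeing next letter lengthens the match by one, and dropping the first letter slides it.
    The bound [b] lets this run inside a finite stretch. *)
Lemma window_propagate i j n b :
  (forall t, j + t < b ->
     window x (i + t) n = window x (j + t) n -> x (i + t + n) = x (j + t + n)) ->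
  window x i n = window x j n ->
  forall t, j + t <= b -> window x (i + t) n = window x (j + t) n.
Proof.
move=> D e; elim=> [|t IH] tb; first by rewrite !addn0.
have {}IH := IH (ltac:(lia)).
rewrite -(addn1 t) !addnA.
apply: (@window_shift _ _ n.+1); first by lia.
by apply: windowS => //; apply: D => //; lia.
Qed.

(** A window starting at [i + p] or later equals the one [p] places earlier, so only the first
    [i + p] starts count. *)
Lemma factor_complexity_periodic i p : 0 < p ->
  (forall t, x (i + t) = x (i + p + t)) -> forall n, factor_complexity x n <= i + p.
Proof.
move=> p0 per n.
have red j : exists2 k, k < i + p & window x j n = window x k n.
  elim/ltn_ind: j => j IH; have [ji|ij] := ltnP j (i + p); first by exists j.
  have [|k kip ek] := IH (j - p); first by lia.
  exists k => //; rewrite -ek; apply/eq_window => m mn.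
  have -> : j + m = i + p + (j - p - i + m) by lia.
  by rewrite -per; congr (x _); lia.
pose h (k : 'I_(i + p)) := window x k n.
rewrite -[leqRHS]card_ord; apply: leq_trans (leq_imset_card h _).
apply/subset_leq_card/fintype.subsetP => u /in_factors[j ->].
have [k kip ->] := red j; apply/imsetP; exists (Ordinal kip) => //.
Qed.

End Windows.

(** * Aperiodicity and bounded repetitions *)

Section Aperiodic.

Variables (A : finType) (x : nat -> A).

Definition right_special n := right_special_at x (fun=> True) n.

Definition eventually_periodic :=
  exists i p, 0 < p /\ forall t, x (i + t) = x (i + p + t).

Lemma right_specialP i j n : window x i n = window x j n ->
  x (i + n) <> x (j + n) -> window x i n \in right_special n.
Proof. by move=> e ne; rewrite inE; apply/asboolP; exists i, j. Qed.

Lemma card_right_special n :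
  #|right_special n| + factor_complexity x n <= factor_complexity x n.+1.
Proof. by rewrite /factor_complexity !factorsE leq_card_right_special. Qed.

Hypothesis x_aper : ~ eventually_periodic.

Lemma aperiodic_break i p : 0 < p -> exists2 t, i <= t & x t <> x (t + p).
Proof.
move=> p0; apply: contrapT => H; apply: x_aper; exists i, p; split=> // t.
rewrite addnAC; apply: contrapT => ne; apply: H; exists (i + t) => //.
exact: leq_addr.
Qed.

(** If all windows from [a] on determined their next letter, a repeated window, supplied by the
    pigeonhole principle, would make [x] eventually periodic. *)
Lemma aperiodic_right_special a n :
  exists2 i, a <= i & window x i n \in right_special n.
Proof.
apply: contrapT => H; apply: x_aper.
have [i [j [ai ij _ e]]] := pigeonhole_window x a n.
exists (i + n), (j - i); split; first by lia.
move=> t; rewrite addnAC.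
have -> : i + n + (j - i) + t = j + t + n by lia.
have D t' : window x (i + t') n = window x (j + t') n ->
    x (i + t' + n) = x (j + t' + n).
  move=> e'; apply: contrapT => ne; apply: H; exists (i + t'); first by lia.
  exact: right_specialP e' ne.
apply: (D); apply: (@window_propagate _ x i j n (j + t)) => // t' _; exact: D.
Qed.

Hypothesis right_special_unique : forall n, #|right_special n| <= 1.

(* A run of period [p] that is long enough shows that the right special factor
   of each length has period [p].  On the other hand, among runs of unbounded
   lengths two have distinct lengths but the same start (including the letter
   before the run, which breaks the period); the shorter one, taken together
   with that letter, is then a right special factor without period [p]. *)
Lemma aperiodic_bounded_powers p : 0 < p ->
  exists L, forall i, exists2 t, t < L & x (i + t) <> x (i + t + p).
Proof.
move=> p0; apply: contrapT => H.
have long L : exists i, forall t, t < L -> x (i + t) = x (i + t + p).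
  apply: contrapT => nL; apply: H; exists L => i.
  apply: contrapT => ni; apply: nL; exists i => t tL.
  by apply: contrapT => ne; apply: ni; exists t.
pose brk t := x t != x (t + p).
pose run s e := [/\ brk s, s < e, forall t, s < t < e -> ~~ brk t & brk e].
have long_run L : exists s e, run s e /\ L <= e - s.
  have [t0 _ /eqP bt0] := aperiodic_break 0 p0.
  (* This stretch is longer than [t0], so it cannot start at or before [t0] without covering the
     break there. *)
  have [i hi] := long (L + t0).+1.
  have it0 : t0 < i.
    rewrite ltnNge; apply/negP => it0; move/negP: bt0; apply.
    have -> : t0 = i + (t0 - i) by lia.
    by rewrite hi //; lia.
  have exs : exists s, brk s && (s < i) by exists t0; rewrite /brk bt0.
  have bds s : brk s && (s < i) -> s <= i by case/andP => _ /ltnW.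
  case: (ex_maxnP exs bds) => s /andP[bs si] smax.
  have [t1 it1 /eqP bt1] := aperiodic_break i p0.
  have exe : exists e, brk e && (i <= e) by exists t1; rewrite /brk bt1.
  case: (ex_minnP exe) => e /andP[be ie] emin.
  have ie' : i + (L + t0).+1 <= e.
    rewrite leqNgt; apply/negP => eL; move/eqP: be; apply.
    have -> : e = i + (e - i) by lia.
    by rewrite hi //; lia.
  exists s, e; split; last by lia.
  split=> // [|t /andP[st te]]; first by lia.
  apply/negP => bt; have [ti|it] := ltnP t i.
    by have := smax t; rewrite bt ti /= => /(_ isT); lia.
  by have := emin t; rewrite bt it /= => /(_ isT); lia.
(* For each [c] that starts a run, [m c] is the length of one such run; the run at [s2] below is
   longer than all of these. *)
have /choice[m mP] : forall c : p.+1.-tuple A, exists d,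
    (exists s e, run s e /\ window x s p.+1 = c) ->
    exists s, run s (s + d) /\ window x s p.+1 = c.
  move=> c; have [[s [e [r ec]]]|n] := pselect
    (exists s e, run s e /\ window x s p.+1 = c); last by exists 0.
  exists (e - s) => _; exists s; split=> //.
  by have -> : s + (e - s) = e by case: r => _ ? _ _; lia.
have [s2 [e2 [r2 d2]]] := long_run (\max_c m c).+1.
set c := window x s2 p.+1; set d := m c.
have [s1 [r1 ec]] : exists s, run s (s + d) /\ window x s p.+1 = c.
  by apply: mP; exists s2, e2.
have dmax : d <= \max_c m c by exact: leq_bigmax.
case: r1 r2 => bs1 d0 in1 be1 [bs2 _ in2 _].
have agree k : k < d + p -> x (s1 + k) = x (s2 + k).
  elim/ltn_ind: k => k IH kd; have [kp|pk] := ltnP k p.+1.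
    by move/eq_window: ec; apply.
  have := in1 (s1 + (k - p)); have := in2 (s2 + (k - p)).
  rewrite /brk !negbK -!addnA subnK; last by lia.
  by move=> /(_ (ltac:(lia)))/eqP <- /(_ (ltac:(lia)))/eqP <-; apply: IH; lia.
(* At offset [d] the run at [s1] ends while the one at [s2] continues, so the letters at offset
   [d + p] differ. *)
have rs1 : window x s1 (d + p) \in right_special (d + p).
  apply: (@right_specialP _ s2); first exact/eq_window.
  rewrite !addnA; have := in2 (s2 + d); rewrite /brk negbK.
  move=> /(_ (ltac:(lia)))/eqP <-; rewrite -agree; last by lia.
  exact/nesym/eqP.
have [s3 [e3 [[_ _ in3 be3] d3]]] := long_run (d + p).+1.
(* A shift by [p] preserves the window of length [d + p] that ends just before [e3], but the break
   at [e3] changes the next letter. *)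
pose i3 := e3 - (d + p).
have in3' t : t < d + p -> x (i3 + t) = x (i3 + p + t).
  move=> td; have := in3 (i3 + t); rewrite /brk negbK addnAC => H3.
  by apply/eqP/H3; lia.
have rs3 : window x i3 (d + p) \in right_special (d + p).
  apply: (@right_specialP _ (i3 + p)); first exact/eq_window.
  rewrite addnAC subnK; last by lia.
  exact/eqP.
have /card_le1_eqP/(_ _ _ rs3 rs1)/eq_window e13 := right_special_unique (d + p).
move/eqP: bs1; apply.
have e0 : x s1 = x i3 by have := e13 0; rewrite !addn0; apply; lia.
have ep : x (s1 + p) = x (i3 + p) by apply: e13; lia.
by rewrite e0 ep; have := in3' 0; rewrite !addn0; apply; lia.
Qed.

End Aperiodic.

(** * Uniform recurrence of Sturmian sequences *)

Definition uniformly_recurrent (A : finType) (x : nat -> A) : Prop :=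
  forall a n, exists N, forall i, exists2 j,
    i <= j < i + N & window x j n = window x a n.

Section Sturmian.

Variables (A : finType) (x : nat -> A).
Hypothesis x_st : sturmian x.

Lemma sturmian_aperiodic : ~ eventually_periodic x.
Proof.
move=> [i [p [p0 /(factor_complexity_periodic p0)/(_ (i + p))]]].
by rewrite x_st ltnn.
Qed.

Lemma sturmian_right_special n : #|right_special x n| <= 1.
Proof. by have := card_right_special x n; rewrite !x_st; lia. Qed.

(* A long stretch avoiding a factor of length [n] has at most [n] windows of
   length [n], so by the finite version of the Morse-Hedlund argument it is
   periodic with a bounded period, up to a bounded prefix. *)
Lemma sturmian_uniformly_recurrent : uniformly_recurrent x.
Proof.
move=> a n; apply: contrapT => H.
(* The period [q] found below is at most [Q], hence divides [p], so one bound [L] serves all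
   candidate periods. *)
pose Q := #|A| ^ n; pose p := Q`!.
have [L /= longP] := aperiodic_bounded_powers sturmian_aperiodic
  sturmian_right_special (fact_gt0 Q).
pose N := Q + p + L + 1.
have [i avoid] : exists i, forall j, i <= j < i + N ->
    window x j n <> window x a n.
  apply: contrapT => nN; apply: H; exists N => i.
  by apply: contrapT => ni; apply: nN; exists i => j ij e; apply: ni; exists j.
pose I j := i <= j < i + N.
have Ii : I i by rewrite /I /N; lia.
have A0 : 0 < #|A| by apply/card_gt0P; exists (x 0).
have cardIn : #|windows_at x I n| <= n.
  rewrite -ltnS -(x_st n); apply/proper_card/properP; split.
    apply/fintype.subsetP => u; rewrite inE => /asboolP[j _ ->].
    exact: mem_window.
  exists (window x a n); first exact: mem_window.
  by rewrite inE; apply/asboolP => -[j /avoid ne /esym].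
(* Strict growth at every [k < n] would give more than [n] windows of length [n]. *)
have [k kn cardk] : exists2 k, k < n &
    #|windows_at x I k.+1| <= #|windows_at x I k|.
  apply: contrapT => nk.
  suff /(_ n (leqnn n)) : forall k, k <= n -> k < #|windows_at x I k| by lia.
  elim=> [_|k IH kn].
    apply/card_gt0P; exists (window x i 0).
    by rewrite inE; apply/asboolP; exists i.
  apply: leq_ltn_trans (IH (ltnW kn)) _; rewrite ltnNge; apply/negP => le.
  by apply: nk; exists k.
have D s t : I s -> I t -> window x s k = window x t k ->
    x (s + k) = x (t + k).
  move=> Is It e; apply: contrapT => ne.
  have : window x s k \in right_special_at x I k.
    by rewrite inE; apply/asboolP; exists s, t.
  suff -> : right_special_at x I k = finset.set0 by rewrite finset.in_set0.
  apply/eqP; rewrite -cards_eq0.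
  by have := leq_card_right_special x I k; lia.
have [s [t [si st ti est]]] := pigeonhole_window x i k.
have QkQ : #|A| ^ k <= Q by rewrite leq_pexp2l // ltnW.
pose q := t - s.
have qp r : q + r < N - Q -> x (s + k + r) = x (s + k + (q + r)).
  move=> qr; have -> : s + k + r = s + r + k by lia.
  have -> : s + k + (q + r) = t + r + k by rewrite /q; lia.
  apply: (D); [rewrite /I; lia|rewrite /I; lia|].
  apply: (@window_propagate _ x s t k (t + r)) => // r' r'r; apply: (D);
    rewrite /I; lia.
have cq c r : c * q + r < N - Q -> x (s + k + r) = x (s + k + (c * q + r)).
  elim: c => [//|c IH] cr.
  have -> : c.+1 * q + r = q + (c * q + r) by lia.
  by rewrite -qp ?IH //; lia.
have qdvd : q %| p by apply: dvdn_fact; rewrite /q; lia.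
have [r rL] := longP (s + k); apply.
have -> : s + k + r + Q`! = s + k + (p %/ q * q + r) by rewrite divnK //; lia.
by apply: cq; rewrite divnK //; lia.
Qed.

End Sturmian.

(** * Uniform recurrence of morphic images *)

Section MorphicImage.

Variables (A B : finType) (f : seq A -> seq B) (z : nat -> A) (w : nat -> B).
Hypothesis f_mor : word_morphism f.
Hypothesis f_nonerasing : forall c, f [:: c] <> [::].
Hypothesis wE : is_image f z w.

Let pos m := size (f (mkseq z m)).

Lemma image_mkseqD m n :
  f (mkseq z (m + n)) = f (mkseq z m) ++ f (window z m n).
Proof.
rewrite -f_mor /mkseq iotaD map_cat add0n; congr (f (_ ++ _)).
have -> : iota m n = [seq m + k | k <- iota 0 n] by rewrite -iotaDl addn0.
by rewrite -map_comp.
Qed.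

Let posS m : pos m.+1 = pos m + size (f [:: z m]).
Proof. by rewrite /pos -addn1 image_mkseqD size_cat /= /mkseq /= addn0. Qed.

Let pos0 : pos 0 = 0.
Proof.
by have /(congr1 size) := f_mor [::] [::]; rewrite size_cat /pos /mkseq /=; lia.
Qed.

Let leq_pos m : m <= pos m.
Proof.
elim: m => // m IH; rewrite posS.
have : 0 < size (f [:: z m]) by rewrite lt0n size_eq0; apply/eqP.
by lia.
Qed.

(** Both words are prefixes of a common image and have the same length. If [m' < m], comparing
    lengths forces the image of the remaining letters to be empty. *)
Lemma is_image_mkseq m : mkseq w (pos m) = f (mkseq z m).
Proof.
have [m'] := wE (pos m).
have [mm'|/ltnW m'm] := leqP m m'.
  rewrite -(subnKC mm') image_mkseqD => /prefixP[s /eqP].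
  by rewrite eqseq_cat ?size_mkseq // => /andP[/eqP <-].
rewrite -[in X in _ -> _ = X](subnKC m'm) image_mkseqD => /prefixP[s e].
move: (congr1 size (image_mkseqD m' (m - m'))).
rewrite subnKC // -/(pos m) e !size_cat size_mkseq => es.
have : size s + size (f (window z m' (m - m'))) == 0.
  by rewrite -(eqn_add2l (pos m)) addnA -es addn0.
rewrite addn_eq0 !size_eq0 => /andP[/eqP -> /eqP ->].
by rewrite !cats0.
Qed.

(** As no letter is erased, the window of [w] at [a] lies in the image of the first [a + n] letters
    of [z]. Each return of this prefix brings the window back, and gaps stretch by a factor of at
    most [M]. *)
Lemma image_uniformly_recurrent :
  uniformly_recurrent z -> uniformly_recurrent w.
Proof.
move=> z_ur a n.
have [N zN] := z_ur 0 (a + n).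
pose M := \max_c size (f [:: c]).
have leM m : pos m.+1 <= pos m + M.
  by rewrite posS leq_add2l; exact: (leq_bigmax (z m)).
have leNM m k : pos (m + k) <= pos m + k * M.
  by elim: k => [|k IH]; rewrite ?addn0 ?addnS //; have := leM (m + k); lia.
have lpos m k : pos m <= pos (m + k).
  by elim: k => [|k IH]; rewrite ?addn0 ?addnS // posS; lia.
exists (M + N * M + a + 1) => i.
(* The least such [j] gives the first image that starts at or after [i], at most [M] places
   later. *)
have ex : exists j, i <= pos j by exists i.
case: (ex_minnP ex) => j0 ij0 j0min.
have j0M : pos j0 <= i + M.
  case: j0 {ij0} j0min => [|j0] j0min; first by rewrite pos0.
  apply: leq_trans (leM j0) _; rewrite leq_add2r leqNgt; apply/negP => lt.
  by have := j0min j0 (ltnW lt); lia.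
have [j /andP[j0j jN] ej] := zN j0.
have j0d := lpos j0 (j - j0); have jd := leNM j0 (j - j0).
have jNM : (j - j0) * M <= N * M by rewrite leq_mul2r; lia.
rewrite subnKC // in j0d jd.
exists (pos j + a); first by lia.
apply/eq_window => k kn; rewrite -addnA.
have akn : a + k < pos (a + n) by have := leq_pos (a + n); lia.
have posjD : pos (j + (a + n)) = pos j + pos (a + n).
  by rewrite /pos image_mkseqD size_cat ej.
transitivity (nth (w 0) (f (mkseq z (j + (a + n)))) (pos j + (a + k))).
  by rewrite -is_image_mkseq nth_mkseq // posjD ltn_add2l.
rewrite image_mkseqD nth_cat -/(pos j) ltnNge leq_addr ej addKn.
have -> : window z 0 (a + n) = mkseq z (a + n) :> seq A by [].
by rewrite /= -is_image_mkseq nth_mkseq.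
Qed.

End MorphicImage.

(** * Palindromes in reversal-closed aperiodic sequences *)

Section Reversal.

Variables (B : finType) (w : nat -> B).
Hypothesis w_rev : reversal_closed w.
Hypothesis w_aper : ~ eventually_periodic w.

Definition palindromes n := [set u in factors w n | rev u == u].

Let special n := [set u : n.-tuple B |
  (u \in right_special w n) || ([tuple of rev u] \in right_special w n)].

Let special_rev n (u : n.-tuple B) :
  ([tuple of rev u] \in special n) = (u \in special n).
Proof.
have e : [tuple of rev [tuple of rev u]] = u by apply: val_inj; rewrite /= revK.
by rewrite !finset.in_set e orbC.
Qed.

Let nonspecial_next i j n : window w i n \notin special n ->
  window w i n = window w j n -> w (i + n) = w (j + n).
Proof.
move=> ns e; apply: contrapT => ne; move/negP: ns; apply.
by rewrite finset.in_set (right_specialP e ne).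
Qed.

Let rev_window i j n : (forall k, k < n -> w (j + k) = w (i + (n - k.+1))) ->
  [tuple of rev (window w i n)] = window w j n.
Proof.
move=> e; apply: val_inj; apply: (@eq_from_nth _ (w 0)) => [|k].
  by rewrite !size_tuple.
rewrite [X in k < X]size_tuple => kn.
rewrite nth_rev ?size_tuple // !nth_window ?e //; lia.
Qed.

Lemma reversal_closed_window i n :
  exists j, forall k, k < n -> w (j + k) = w (i + (n - k.+1)).
Proof.
have [|j] := w_rev (w := window w i n); first by exists i; rewrite size_tuple.
rewrite size_rev size_tuple => e; exists j => k kn.
rewrite -(nth_window w (w 0) j kn) /window /= -e nth_rev size_tuple // nth_window //.
by lia.
Qed.

(* The path from a special window to the next special one, with [q] half-way, is
   determined by its first window and the letter following it, stored in [c]. *)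
Let path_to n (q : n.-tuple B) (c : n.-tuple B * B) := exists j t,
  [/\ 0 < t, forall s, 0 < s < t + t -> window w (j + s) n \notin special n,
      (window w j n \in special n) && (window w (j + (t + t)) n \in special n),
      window w (j + t) n = q & c = (window w j n, w (j + n))].

(* Extend the palindrome to the right up to the first special window; the
   reversal of this extension is a factor ending with the palindrome, and is
   followed by the same extension. *)
Let palindrome_path n (q : n.-tuple B) :
  q \in palindromes n :\: special n -> exists c, path_to q c.
Proof.
rewrite finset.in_setD => /andP[nsq].
rewrite finset.in_set => /andP[/in_factors[i qE] /eqP q_pal].
have [i' ii' rs_i'] := aperiodic_right_special w_aper i n.
have ex : exists t, window w (i + t) n \in special n.
  by exists (i' - i); rewrite finset.in_set subnKC // rs_i'.
case: (ex_minnP ex) => t spt tmin.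
have ns s : s < t -> window w (i + s) n \notin special n.
  by move=> st; apply/negP => /tmin; rewrite leqNgt st.
(* The reversal of the stretch of length [n + t] at [i] occurs at [j], so [q] reappears at
   [j + t]. *)
have [j jE] := reversal_closed_window i (n + t).
have revE s : s <= t ->
    [tuple of rev (window w (i + (t - s)) n)] = window w (j + s) n.
  move=> st; apply: rev_window => k kn; rewrite -addnA jE; last by lia.
  by congr w; lia.
have qj : window w (j + t) n = q.
  by rewrite -revE // subnn addn0 -qE; exact: val_inj.
(* The windows before the special one determine their next letters, so both copies of [q] continue
   alike up to it. *)
have fwd s : s <= t -> window w (i + s) n = window w (j + t + s) n.
  move=> st; apply: (@window_propagate _ w i (j + t) n (j + t + t)); last 1 first.
  - by lia.
  - by move=> s' s't; apply: nonspecial_next; apply: ns; lia.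
  - by rewrite qj.
exists (window w j n, w (j + n)), j, t; split=> //.
- by rewrite lt0n; apply: contraNneq nsq => t0; rewrite qE -(addn0 i) -t0.
- move=> s /andP[s0 stt]; have [st|ts] := leqP s t.
    by rewrite -revE // special_rev; apply: ns; lia.
  have -> : j + s = j + t + (s - t) by lia.
  by rewrite -fwd; [apply: ns|]; lia.
- rewrite addnA -fwd // spt andbT.
  by have := revE 0 isT; rewrite subn0 addn0 => <-; rewrite special_rev.
Qed.

(** The data in [c] fix the second window, and from there each non-special window fixes the next.
    Both paths stop at their first special window, so they have equal length and the same
    midpoint. *)
Let path_to_inj n (q q' : n.-tuple B) c : path_to q c -> path_to q' c -> q = q'.
Proof.
move=> [j [t [t0 nst /andP[_ spt] <- ->]]] [j' [t' [t'0 nst' /andP[_ spt'] <- /pair_equal_spec[e en]]]].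
have agree s : 0 < s <= t + t -> s <= t' + t' ->
    window w (j + s) n = window w (j' + s) n.
  elim: s => [//|s IH] st st'; rewrite -(addn1 s) !addnA.
  apply: (@window_shift _ w _ _ n.+1); first by lia.
  have [->|s0] := posnP s; first by rewrite !addn0; exact: windowS.
  apply: windowS; first by apply: IH; lia.
  by apply: nonspecial_next; [apply: nst|apply: IH]; lia.
have [tt'|tt'|tt'] := ltngtP t t'.
- have := nst' (t + t); rewrite -agree; [|lia|lia].
  by rewrite spt => /(_ (ltac:(lia))).
- have := nst (t' + t'); rewrite agree; [|lia|lia].
  by rewrite spt' => /(_ (ltac:(lia))).
- by rewrite -tt'; apply: agree; lia.
Qed.

(** The special palindromes account for the one added to [#|B|]; a non-special one is determined by
    the special window that starts its path and the letter after it. *)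
Lemma card_palindromes n :
  #|palindromes n| <= 2 * #|right_special w n| * #|B|.+1.
Proof.
have cardS : #|special n| <= 2 * #|right_special w n|.
  rewrite mul2n -addnn.
  pose rv (u : n.-tuple B) := [tuple of rev u].
  have rvK u : rv (rv u) = u by apply: val_inj; rewrite /= revK.
  rewrite -[in X in _ + X](card_imset _ (can_inj rvK)).
  apply: leq_trans (leq_card_setU _ _).
  apply/subset_leq_card/fintype.subsetP => u; rewrite finset.in_set finset.in_setU.
  case/orP => [->//|ru]; apply/orP; right; apply/imsetP; exists (rv u) => //.
rewrite -(cardsID (special n)) mulnS; apply: leq_add.
  by apply: leq_trans cardS; rewrite subset_leq_card // finset.subsetIr.
apply: leq_trans (_ : #|special n| * #|B| <= _); last by rewrite leq_mul2r cardS orbT.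
have /choice[g gP] : forall q : n.-tuple B, exists c,
    q \in palindromes n :\: special n -> path_to q c.
  move=> q; have [/palindrome_path[c qc]|_] :=
    boolP (q \in palindromes n :\: special n); first by exists c.
  by exists (q, w 0).
rewrite -[X in _ * X]cardsT -cardsX.
rewrite -(@card_in_imset _ _ g); last first.
  by move=> q q' /gP qc /gP qc' e; rewrite -e in qc'; exact: path_to_inj qc qc'.
apply/subset_leq_card/fintype.subsetP => _ /imsetP[q /gP[j [t [_ _ /andP[spj _] _ ->]]] ->].
by rewrite finset.in_setX spj finset.in_setT.
Qed.

End Reversal.

(** * Counting classes under reflection *)

Section ReflectionClasses.

Variables (B : finType) (n : nat).
Implicit Types (D F : {set n.-tuple B}) (u v : n.-tuple B).

Let cls D u := [set v in D | refl_equiv u v].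
Let rv u : n.-tuple B := [tuple of rev u].

Let rvK : involutive rv.
Proof. by move=> u; apply: val_inj; rewrite /= revK. Qed.

Let refl_equivE u v : refl_equiv u v = (v == u) || (v == rv u).
Proof. by []. Qed.

Let clsP D u v : u \in D -> cls D u = cls D v -> u = v \/ u = rv v.
Proof.
move=> uD e; have : u \in cls D u by rewrite finset.in_set uD refl_equivE eqxx.
by rewrite e finset.in_set uD refl_equivE /= => /orP[] /eqP; [left|right].
Qed.

Let cls_rv D u : cls D (rv u) = cls D u.
Proof. by apply/finset.setP => v; rewrite !finset.in_set !refl_equivE rvK orbC. Qed.

Let partE D : equivalence_partition (fun u v => refl_equiv u v) D = cls D @: D.
Proof. by []. Qed.

Lemma card_refl_partition_le D :
  #|equivalence_partition (fun u v => refl_equiv u v) D| <= #|D|.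
Proof. by rewrite partE leq_imset_card. Qed.

(** Distinct words of [F] in one class would be reversals of each other. *)
Lemma card_refl_partition_chiral D F : F \subset D ->
  (forall u, u \in F -> [tuple of rev u] \notin F) ->
  #|F| <= #|equivalence_partition (fun u v => refl_equiv u v) D|.
Proof.
move=> /fintype.subsetP sFD chiral; rewrite partE -(@card_in_imset _ _ (cls D)).
  by apply/subset_leq_card/imsetS/fintype.subsetP.
move=> u v uF vF /(clsP (sFD _ uF))[//|e].
by have := chiral _ vF; rewrite -/(rv v) -e uF.
Qed.

Let card_fibers (D : {set n.-tuple B}) (h : n.-tuple B -> {set n.-tuple B}) :
  #|D| = \sum_(c in h @: D) #|[set u in D | h u == c]|.
Proof.
rewrite -sum1_card (partition_big_imset h) /=; apply: eq_bigr => c _.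
by rewrite -sum1_card; apply: eq_bigl => u; rewrite finset.in_set.
Qed.

Lemma card_refl_partition_ge D :
  #|D| <= 2 * #|equivalence_partition (fun u v => refl_equiv u v) D|.
Proof.
rewrite partE (card_fibers D (cls D)) mulnC -sum_nat_const.
apply: leq_sum => _ /imsetP[v vD ->].
apply: (@leq_trans #|[set v; rv v]|); last by rewrite cards2; case: eqP.
apply/subset_leq_card/fintype.subsetP => u; rewrite finset.in_set => /andP[uD /eqP].
by move/(clsP uD) => [] ->; rewrite finset.in_set2 eqxx ?orbT.
Qed.

(** Words outside [F] and palindromes in [F] contribute at most one class each. The other words of
    [F] pair off with their reversals, giving at most half as many classes. *)
Lemma card_refl_partition_closed D F : F \subset D ->
  (forall u, u \in F -> [tuple of rev u] \in F) ->
  2 * #|equivalence_partition (fun u v => refl_equiv u v) D| <=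
    2 * #|D :\: F| + 2 * #|[set u in F | rev u == u]| + #|F|.
Proof.
move=> sFD F_rev; rewrite partE; set P := [set u in F | _].
have PF : P \subset F by apply/fintype.subsetP => u; rewrite finset.in_set => /andP[].
pose Q := F :\: P.
have Q_rev u : u \in Q -> rv u \in Q.
  rewrite !finset.in_setD !finset.in_set => /andP[nu uF]; rewrite F_rev //= andbT.
  by apply: contra nu; rewrite uF revK eq_sym.
have cardQ : 2 * #|cls D @: Q| <= #|Q|.
  rewrite [leqRHS](card_fibers Q (cls D)) mulnC -sum_nat_const.
  apply: leq_sum => _ /imsetP[u uQ ->].
  apply: (@leq_trans #|[set u; rv u]|).
    rewrite cards2; case: eqP => // e; move: (uQ).
    rewrite finset.in_setD !finset.in_set => /andP[+ uF].
    by rewrite uF /= => /eqP[]; rewrite {2}e.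
  apply/subset_leq_card/fintype.subsetP => v; rewrite finset.in_set2.
  by case/orP => /eqP ->; rewrite finset.in_set ?cls_rv eqxx andbT ?Q_rev.
have eD : D :\: F :|: (P :|: Q) = D.
  apply/finset.setP => u; rewrite finset.in_setU finset.in_setD.
  rewrite finset.in_setU finset.in_setD.
  have /fintype.subsetP/(_ u) := sFD; have /fintype.subsetP/(_ u) := PF.
  case: (u \in P); case: (u \in F); case: (u \in D) => //= PFu FDu.
  - by have := FDu isT.
  - by have := PFu isT.
  - by have := FDu isT.
rewrite -[in X in #|_ @: X|]eD finset.setUA !imsetU.
have [+ _] := leq_card_setU (cls D @: (D :\: F) :|: cls D @: P) (cls D @: Q).
have [+ _] := leq_card_setU (cls D @: (D :\: F)) (cls D @: P).
have := leq_imset_card (cls D) (D :\: F); have := leq_imset_card (cls D) P.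
have : #|Q| <= #|F| by rewrite subset_leq_card // finset.subsetDl.
have arith (f p q d cp cq cd u1 u2 : nat) : 2 * cq <= q -> q <= f ->
    cp <= p -> cd <= d -> u1 <= cd + cp -> u2 <= u1 + cq ->
    2 * u2 <= 2 * d + 2 * p + f by lia.
by move: cardQ; exact: arith.
Qed.

End ReflectionClasses.

(** * Effect of a finite prefix on the factors *)

Section Prepend.

Variables (B : finType) (y : seq B) (w : nat -> B).

Lemma window_prepend i n :
  window (prepend y w) (size y + i) n = window w i n.
Proof.
apply: val_inj; apply: (@eq_from_nth _ (w 0)); rewrite !size_tuple // => k kn.
rewrite !nth_window // /prepend nth_default; last by lia.
by rewrite -addnA addKn.
Qed.

Lemma factors_prepend n : factors w n \subset factors (prepend y w) n.
Proof.
apply/fintype.subsetP => u /in_factors[i ->].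
by rewrite -window_prepend mem_window.
Qed.

(** A factor that starts past [y] is a factor of [w], so a new one starts at one of the [size y]
    positions in [y]. *)
Lemma card_factors_prependD n :
  #|factors (prepend y w) n :\: factors w n| <= size y.
Proof.
pose h (k : 'I_(size y)) := window (prepend y w) k n.
rewrite -[leqRHS]card_ord; apply: leq_trans (leq_imset_card h _).
apply/subset_leq_card/fintype.subsetP => u.
rewrite finset.in_setD => /andP[+ /in_factors[i ui]]; rewrite {}ui.
have [iy _|yi] := ltnP i (size y); first by apply/imsetP; exists (Ordinal iy).
by rewrite -(subnKC yi) window_prepend mem_window.
Qed.

Lemma factor_complexity_prepend n :
  factor_complexity w n <= factor_complexity (prepend y w) n <=
    factor_complexity w n + size y.
Proof.
rewrite subset_leq_card ?factors_prepend //= /factor_complexity.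
rewrite -(cardsID (factors w n)) (finset.setIidPr (factors_prepend n)).
by rewrite leq_add2l card_factors_prependD.
Qed.

End Prepend.

(** * The two cases, with explicit constants *)

Lemma uniformly_recurrent_chiral (B : finType) (w : nat -> B) :
  uniformly_recurrent w -> ~ reversal_closed w ->
  exists N, forall n, N <= n ->
    forall u : n.-tuple B, u \in factors w n -> [tuple of rev u] \notin factors w n.
Proof.
move=> w_ur nrev.
have [a [m nv]] : exists a m, forall i, window w i m <> rev (window w a m) :> seq B.
  apply: contrapT => H; apply: nrev => v [a vE].
  apply: contrapT => nv; apply: H; exists a, (size v) => i e; apply: nv.
  by exists i; rewrite size_rev {1}vE.
have [N NP] := w_ur a m.
exists (N + m) => n Nn u /in_factors[i ->]; apply/negP => /in_factors[i' e].
(* The word [window w a m] occurs in [u] at offset [j - i], so its reversal occurs in the reversal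
   of [u] at offset [n - (j - i) - m]. *)
have [j ij /eq_window ej] := NP i; apply: (nv (i' + (n - (j - i) - m))).
apply: (@eq_from_nth _ (w 0)); first by rewrite size_rev !size_mkseq.
rewrite size_mkseq => k km.
rewrite nth_mkseq // nth_rev size_mkseq // nth_mkseq -?ej; [|lia|lia].
have kn : n - (j - i) - m + k < n by lia.
rewrite -addnA -(nth_window w (w 0) i' kn) -e /= nth_rev ?size_mkseq // nth_mkseq.
  by congr w; lia.
by lia.
Qed.

Lemma quasi_sturmian_bound (B : finType) (x : nat -> B) : quasi_sturmian x ->
  exists c N, forall n, N <= n ->
    n <= factor_complexity x n + c /\ factor_complexity x n <= n + c.
Proof.
move=> [C [N xC]]; exists `|C|%N, N => n /xC.
by lia.
Qed.

Lemma reflection_complexity_prepend (B : finType) (y : seq B) (w : nat -> B) :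
  quasi_sturmian (prepend y w) -> uniformly_recurrent w ->
  exists K N, forall n, N <= n ->
    if `[< reversal_closed w >] then
      n <= 2 * reflection_complexity (prepend y w) n + K /\
      2 * reflection_complexity (prepend y w) n <= n + K
    else
      n <= reflection_complexity (prepend y w) n + K /\
      reflection_complexity (prepend y w) n <= n + K.
Proof.
move=> /quasi_sturmian_bound[c [N xN]] w_ur.
have cmpl n := factor_complexity_prepend y w n.
case: asboolP => [w_rev|w_nrev]; last first.
  have [N' chiral] := uniformly_recurrent_chiral w_ur w_nrev.
  (* At most [size y] factors come from the prefix, and the rest lie in distinct classes. *)
  exists (c + size y), (N + N') => n nN.
  have [lo hi] := xN n (ltac:(lia)); have /andP[_ cw] := cmpl n.
  have := card_refl_partition_le (factors (prepend y w) n).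
  have := card_refl_partition_chiral (factors_prepend y w n)
    (chiral n (ltac:(lia))).
  rewrite -/(reflection_complexity _ _) -!/(factor_complexity _ _); lia.
have w_aper : ~ eventually_periodic w.
  move=> [i [p [p0 /(factor_complexity_periodic p0) bd]]].
  pose n := N + i + p + c + size y + 1.
  have [lo _] := xN n (ltac:(lia)); have /andP[_] := cmpl n; have := bd n; lia.
(* The complexity of [w] is at most [n.+1 + c] at [n.+1] and at least [n - c - size y] at [n]; the
   difference bounds the number of right special factors. *)
pose pal := 2 * (1 + 2 * c + size y) * #|B|.+1.
have pal_bound n : N <= n -> #|palindromes w n| <= pal.
  move=> nN; apply: leq_trans (card_palindromes w_rev w_aper n) _.
  rewrite leq_mul2r leq_mul2l /=.
  have [lo _] := xN n nN; have [_ hi] := xN n.+1 (leqW nN).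
  have /andP[_ cw] := cmpl n; have /andP[cwS _] := cmpl n.+1.
  rewrite -(leq_add2r (factor_complexity w n)).
  by apply: leq_trans (card_right_special w n) _; lia.
exists (c + 2 * size y + 2 * pal), N => n nN.
have w_revF (u : n.-tuple B) :
    u \in factors w n -> [tuple of rev u] \in factors w n.
  move=> /in_factors[i ->]; rewrite inE; apply/asboolP/w_rev.
  by exists i; rewrite size_tuple.
have [lo hi] := xN n nN; have /andP[cw _] := cmpl n.
have := card_refl_partition_ge (factors (prepend y w) n).
have := card_refl_partition_closed (factors_prepend y w n) w_revF.
have := pal_bound n nN; have := card_factors_prependD y w n.
rewrite -/(reflection_complexity _ _) -!/(factor_complexity _ _).
rewrite -/(palindromes w n); lia.
Qed.

(** If one letter were erased, 01 and 10 would both map to the image of the other letter. *)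
Lemma aperiodic_nonerasing (B : Type) (f : seq bool -> seq B) c :
  word_morphism f -> aperiodic_morphism f -> f [:: c] <> [::].
Proof.
move=> f_mor f_ap fc; apply: f_ap.
rewrite (f_mor [:: false] [:: true]) (f_mor [:: true] [:: false]).
by case: c fc => ->; rewrite /= cats0.
Qed.

(** * Passage to asymptotic notation *)

Import Order.TTheory GRing.Theory Num.Theory.
Local Open Scope ring_scope.
Local Open Scope classical_set_scope.

Lemma bounded_eqaddO (R : realType) (r g : nat -> R) (K : R) (N : nat) :
  (forall n, (N <= n)%N -> `|r n - g n| <= K) ->
  (r : nat -> R^o) = (g : nat -> R^o) +O_\oo (fun=> 1 : R^o).
Proof.
move=> H; apply/eqaddOP; near=> k; near=> n.
rewrite normr1 mulr1; apply: (@le_trans _ _ K); last first.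
  by near: k; apply: nbhs_pinfty_ge; exact: num_real.
by apply: H; near: n; exact: nbhs_infty_ge.
Unshelve. all: by end_near. Qed.

Theorem theorem6p3 (R : realType) (B : finType) (x : nat -> B) (y : seq B)
    (z : nat -> bool) (f : seq bool -> seq B) (fz : nat -> B)
    (x_qs : quasi_sturmian x)
    (z_st : sturmian z)
    (f_mor : word_morphism f)
    (f_ap : aperiodic_morphism f)
    (fzE : is_image f z fz)
    (xE : x = prepend y fz) :
  (reversal_closed fz /\
     (fun n : nat => (reflection_complexity x n)%:R : R^o) =
       (fun n : nat => n%:R / 2 : R^o) +O_\oo (fun=> 1 : R^o))
  \/
  (~ reversal_closed fz /\
     (fun n : nat => (reflection_complexity x n)%:R : R^o) =
       (fun n : nat => n%:R : R^o) +O_\oo (fun=> 1 : R^o)).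
Proof.
have fz_ur : uniformly_recurrent fz.
  apply: (image_uniformly_recurrent f_mor _ fzE).
    by move=> c; exact: aperiodic_nonerasing.
  exact: sturmian_uniformly_recurrent.
rewrite {}xE in x_qs *.
have [K [N]] := reflection_complexity_prepend x_qs fz_ur.
case: asboolP => fz_rev bd; [left|right]; split=> //.
- apply: (@bounded_eqaddO R (fun n => (reflection_complexity _ n)%:R)
    (fun n => n%:R / 2) K%:R N) => n /bd[].
  rewrite mul2n -addnn -!(ler_nat R) !natrD => lo hi.
  by rewrite ler_norml; apply/andP; split; lra.
- apply: (@bounded_eqaddO R (fun n => (reflection_complexity _ n)%:R)
    (fun n => n%:R) K%:R N) => n /bd[].
  rewrite -!(ler_nat R) !natrD => lo hi.
  by rewrite ler_norml; apply/andP; split; lra.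
Qed.
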